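(* Let $d=1$. Let $\phi:\mathbb{R}\to\mathbb{R}$ be a positive, bounded, continuous function for which there exist $x_0\in\mathbb{R}$ and $z>0$ such that $\phi(x_0+y)=\phi(x_0-y)$ for all $y\in\mathbb{R}$ and $\phi(x_0+z)<\phi(x_0)$. In addition, assume that $\phi$ is decreasing for $x_0<x<x_0+z$ and increasing for $x>x_0+z$. Define $$G(x,m)=\phi(x)\,\sigma_T(m),\qquad\sigma_T(m)=\int_{\mathbb{R}}\phi\,dm,\qquad L(x,v)=\tfrac12|v|^2.$$ Then, for the initial measure $m_0=\delta_{x_0}$, condition $(\sigma)$ holds strictly (for all time horizons $T>0$), and the Lasry–Lions condition (LL) is satisfied strongly by $G$, but uniqueness of equilibria does not hold: there exists a time horizon $T>0$ for which there are at least two distinct mean field game equilibria with initial measure $\delta_{x_0}$.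
   Context: $\mathscr{P}_2(\mathbb{R})$ is the set of Borel probability measures on $\mathbb{R}$ with finite second moment. (LL) for $G$: $\int_{\mathbb{R}}(G(x,m_1)-G(x,m_2))\,d(m_1-m_2)(x)\ge0$ for all $m_1,m_2\in\mathscr{P}_2(\mathbb{R})$. It holds strongly if in addition equality implies that $G(\cdot,m_1)$ and $G(\cdot,m_2)$ are identical. For $T>0$ let $\Gamma=\mathrm{AC}(0,T;\mathbb{R})$ be the space of absolutely continuous curves on $[0,T]$ (with the topology of uniform convergence), $e_t(\gamma)=\gamma(t)$, $\Gamma[x]=\{\gamma\in\Gamma:\gamma(0)=x\}$. For $m_0\in\mathscr{P}_2(\mathbb{R})$, $\mathscr{P}_{m_0}(\Gamma)$ is the set of Borel probability measures $\eta$ on $\Gamma$ with $(e_0)_\sharp\eta=m_0$, with disintegration $\eta(d\gamma)=\int\eta_x(d\gamma)\,dm_0(x)$, $\eta_x$ supported in $\Gamma[x]$. Equilibria: put $J^\eta[\gamma]=\int_0^TL(\gamma_s,\dot\gamma_s)\,ds+G(\gamma_T,(e_T)_\sharp\eta)$ and let $\Gamma^\eta[x]$ be the set of minimizers of $J^\eta$ over $\Gamma[x]$. An equilibrium for $m_0$ is an $\eta\in\mathscr{P}_{m_0}(\Gamma)$ with $\mathrm{spt}(\eta_x)\subseteq\Gamma^\eta[x]$ for $m_0$-a.e. $x$. Condition $(\sigma)$ restricted to a given initial measure $m_0$: for $\sigma\in\mathbb{R}$ let $\Gamma^\sigma[x]$ be the set of minimizers over $\Gamma[x]$ of $J^\sigma[\gamma]=\int_0^TL(\gamma_s,\dot\gamma_s)\,ds+\phi(\gamma_T)\sigma$,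 and $\mathcal{E}_T(\sigma)=\{\sigma_T((e_T)_\sharp\hat\eta):\hat\eta\in\mathscr{P}_{m_0}(\Gamma),\ \mathrm{spt}(\hat\eta_x)\subseteq\Gamma^\sigma[x]\text{ for }m_0\text{-a.e. }x\}$. The condition is: for all $T>0$, $(\tau_1-\tau_2)(\sigma_1-\sigma_2)\le|\sigma_1-\sigma_2|^2$ for all $\sigma_1,\sigma_2\in\mathrm{range}\,\sigma_T=\{\int\phi\,dm:m\in\mathscr{P}_2(\mathbb{R})\}$ and all $\tau_1\in\mathcal{E}_T(\sigma_1)$, $\tau_2\in\mathcal{E}_T(\sigma_2)$. It holds strictly if the inequality is strict whenever $\sigma_1\ne\sigma_2$. *)

(* Defs.v *)
From HB Require Import structures.
From mathcomp Require Import all_boot all_order all_algebra.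
From mathcomp Require Import all_classical all_reals all_analysis.

Set Implicit Arguments.
Unset Strict Implicit.
Unset Printing Implicit Defensive.

Import Order.TTheory GRing.Theory Num.Theory.
Import numFieldTopology.Exports numFieldNormedType.Exports.

Local Open Scope classical_set_scope.
Local Open Scope ring_scope.

Definition absolutely_continuous_on (R : realType) (a b : R) (f : R -> R) :=
  forall e : R, 0 < e -> exists2 d : R, 0 < d &
    forall (n : nat) (l r : 'I_n -> R),
      (forall i, [/\ a <= l i, l i < r i & r i <= b]) ->
      trivIset setT (fun i => `]l i, r i[%classic) ->
      \sum_(i < n) (r i - l i) < d ->
      \sum_(i < n) `|f (r i) - f (l i)| < e.

Definition topological_support (X : topologicalType) (R : realType)
    (mu : set X -> \bar R) : set X :=
  [set x | forall U : set X, open U -> U x -> (0 < mu U)%E].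

(* A curve on [0, T] is represented by its unique extension to the line that
   is constant on each side of [0, T], so that Leibniz equality of curves is
   equality on [0, T]. *)
Definition curve_set (R : realType) (T : {posnum R}) :
    set {uniform` `[(0 : R), T%:num]%classic -> R} :=
  [set g : R -> R |
    [/\ absolutely_continuous_on 0 T%:num g,
        forall t, t <= 0 -> g t = g 0 &
        forall t, T%:num <= t -> g t = g T%:num]].

Definition curve (R : realType) (T : {posnum R}) : Type :=
  set_type (@curve_set R T).

HB.instance Definition _ (R : realType) (T : {posnum R}) :=
  Topological.copy (curve T) (set_type (@curve_set R T)).

Definition curve_fun (R : realType) (T : {posnum R}) (g : curve T) : R -> R :=
  set_val g.
Coercion curve_fun : curve >-> Funclass.

Fact cst_curve_subproof (R : realType) (T : {posnum R}) (c : R) :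
  ((fun=> c) : {uniform` `[(0 : R), T%:num]%classic -> R}) \in @curve_set R T.
Proof.
rewrite inE; split => // e e0; exists 1 => // n l r _ _ _.
by rewrite big1// => i _; rewrite subrr normr0.
Qed.

Definition cst_curve (R : realType) (T : {posnum R}) (c : R) : curve T :=
  SigSub (cst_curve_subproof T c).

HB.instance Definition _ (R : realType) (T : {posnum R}) :=
  isPointed.Build (curve T) (cst_curve T 0).

Definition borel_curve (R : realType) (T : {posnum R}) :=
  g_sigma_algebraType (@open (curve T)).

Definition ev (R : realType) (T : {posnum R}) (t : R) (g : borel_curve T) : R :=
  curve_fun g t.

Lemma continuous_ev (R : realType) (T : {posnum R}) (t : R) :
  continuous (fun g : curve T => curve_fun g t).
Proof.
have [s sT gE] : exists2 s : R, `[0, T%:num]%classic s &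
    forall g : curve T, curve_fun g t = curve_fun g s.
  have [t0|t0] := leP t 0.
    exists 0; first by rewrite /= in_itv/= lexx/=.
    by case=> g /=; rewrite /curve_fun set_valE/= inE => -[_ /(_ _ t0)].
  have [Tt|tT] := leP T%:num t.
    exists T%:num; first by rewrite /= in_itv/= lexx andbT.
    by case=> g /=; rewrite /curve_fun set_valE/= inE => -[_ _ /(_ _ Tt)].
  by exists t; rewrite //= in_itv/= !ltW.
move=> g U; rewrite /= gE => /nbhsP[E entE EU].
have : nbhs (set_val g : {uniform` `[(0 : R), T%:num]%classic -> R})
    [set h : R -> R | U (h s)].
  apply/uniform_nbhs; exists E; split=> // h Eh.
  by apply: EU; apply/xsectionP; exact: Eh.
move/(@initial_continuous _ _ (@set_val _ (@curve_set R T)) g) => nU.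
by apply: (@filterS _ (nbhs g) (nbhs_filter g)) nU => h /=; rewrite gE.
Qed.

Lemma measurable_ev (R : realType) (T : {posnum R}) (t : R) :
  measurable_fun setT (@ev R T t).
Proof.
apply: (measurability _ (measurable_realfun.RGenOpens.measurableE R)).
move=> _ [_ [a [b ->] <-]]; rewrite setTI; apply: sub_sigma_algebra.
by move/continuousP : (@continuous_ev R T t); apply; exact: interval_open.
Qed.

HB.instance Definition _ (R : realType) (T : {posnum R}) (t : R) :=
  isMeasurableFun.Build _ _ _ _ (@ev R T t) (measurable_ev t).

Section mean_field_game.
Variable R : realType.

Definition P2 : set (probability R R) :=
  [set m | (\int[m]_x ((x : R) ^+ 2)%:E < +oo)%E].

Definition sigma_T (phi : R -> R) (m : probability R R) : R :=
  \int[m]_x phi x.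

(* the integral of G(., m1) - G(., m2) against the signed measure m1 - m2 *)
Definition LL_integral (G : R -> probability R R -> R)
    (m1 m2 : probability R R) : R :=
  \int[m1]_x (G x m1 - G x m2) - \int[m2]_x (G x m1 - G x m2).

Definition LL (G : R -> probability R R -> R) :=
  forall m1 m2, P2 m1 -> P2 m2 -> 0 <= LL_integral G m1 m2.

Definition LL_strong (G : R -> probability R R -> R) :=
  LL G /\
  forall m1 m2, P2 m1 -> P2 m2 -> LL_integral G m1 m2 = 0 ->
    forall x, G x m1 = G x m2.

Section horizon.
Variable T : {posnum R}.

Definition curves_from (x : R) : set (curve T) := [set g | g 0 = x].

(* J takes values in \bar R: the action of an absolutely continuous curve
   may be infinite. Such a curve is differentiable almost everywhere; the
   value of derive1 elsewhere does not affect the integral. *)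
Definition J (L : R -> R -> R) (h : R -> R) (g : curve T) : \bar R :=
  (\int[lebesgue_measure]_(s in `[(0 : R)%R, T%:num])
      (L (g s) (derive1 (g : R -> R) s))%:E
   + (h (g T%:num))%:E)%E.

Definition minimizers (L : R -> R -> R) (h : R -> R) (x : R) :
    set (curve T) :=
  [set g | curves_from x g /\
           forall g', curves_from x g' -> (J L h g <= J L h g')%E].

Definition P_init (m0 : probability R R) :
    set (probability (borel_curve T) R) :=
  [set eta | forall A, measurable A ->
    distribution eta (@ev R T 0) A = m0 A].

Definition disintegration (m0 : probability R R)
    (eta : probability (borel_curve T) R)
    (kappa : R.-pker R ~> borel_curve T) :=
  (forall A, measurable A -> eta A = \int[m0]_x kappa x A)%E /\
  {ae m0, forall x,
     topological_support (kappa x : set (curve T) -> \bar R)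
       `<=` curves_from x}.

Definition disintegrates_in (m0 : probability R R) (M : R -> set (curve T))
    (eta : probability (borel_curve T) R) :=
  exists2 kappa : R.-pker R ~> borel_curve T,
    disintegration m0 eta kappa &
    {ae m0, forall x,
       topological_support (kappa x : set (curve T) -> \bar R) `<=` M x}.

Definition equilibrium (L : R -> R -> R) (G : R -> probability R R -> R)
    (m0 : probability R R) (eta : probability (borel_curve T) R) :=
  P_init m0 eta /\
  disintegrates_in m0
    (minimizers L (fun x => G x (distribution eta (@ev R T T%:num)))) eta.

Definition E_T (L : R -> R -> R) (phi : R -> R) (m0 : probability R R)
    (sigma : R) : set R :=
  [set sigma_T phi (distribution eta (@ev R T T%:num)) |
    eta in [set eta | P_init m0 eta /\
      disintegrates_in m0 (minimizers L (fun x => phi x * sigma)) eta]].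

End horizon.

Definition condition_sigma (L : R -> R -> R) (phi : R -> R)
    (m0 : probability R R) :=
  forall (T : {posnum R}) (s1 s2 t1 t2 : R),
    (sigma_T phi @` P2) s1 -> (sigma_T phi @` P2) s2 ->
    E_T T L phi m0 s1 t1 -> E_T T L phi m0 s2 t2 ->
    (t1 - t2) * (s1 - s2) <= `|s1 - s2| ^+ 2.

Definition condition_sigma_strict (L : R -> R -> R) (phi : R -> R)
    (m0 : probability R R) :=
  condition_sigma L phi m0 /\
  forall (T : {posnum R}) (s1 s2 t1 t2 : R),
    (sigma_T phi @` P2) s1 -> (sigma_T phi @` P2) s2 ->
    E_T T L phi m0 s1 t1 -> E_T T L phi m0 s2 t2 ->
    s1 != s2 -> (t1 - t2) * (s1 - s2) < `|s1 - s2| ^+ 2.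

End mean_field_game.

(* In MathComp-Analysis a measure is a total function on sets whose values on
   nonmeasurable sets are arbitrary, so Leibniz inequality is too weak. *)
Definition distinct_measures (R : realType) (d : measure_display)
    (X : measurableType d) (mu nu : probability X R) :=
  exists2 A : set X, measurable A & mu A <> nu A.

(* Main.v *)
From HB Require Import structures.
Require Import Defs.
From mathcomp Require Import all_boot all_order all_algebra.
From mathcomp Require Import all_classical all_reals all_analysis.
From mathcomp Require Import measurable_realfun ring lra.

(** Condition (sigma). For a fixed value sigma, a minimizer trades kinetic
action against phi (endpoint) * sigma, so a larger sigma forces a smaller value
of phi at the endpoint ([minimizers_antitone]). Best responses are therefore
nonincreasing in sigma, and condition (sigma) holds strictly since its left-hand
side is never positive ([kinetic_condition_sigma_strict]). Passing from
individual curves to a plan uses that a measure on curves charges only its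
topological support ([negligible_compl_support]), because the space of curves
is separable.

Condition (LL). The Lasry-Lions integral is the square of
sigma_T m1 - sigma_T m2 ([multiplicative_LL_strong]).

Non-uniqueness. Fix lam > 0 and let y minimize
w |-> (w - x0) ^ 2 / (2 lam) + phi w ([penalized_minimizer]). On the horizon
T = lam / phi y this same y minimizes (w - x0) ^ 2 / (2 T) + phi w * phi y, so
the Dirac mass at the straight line from x0 to y is an equilibrium
([straight_line_equilibrium]). For lam = z ^ 2 / (phi x0 - phi (x0 + z)) the
point x0 + z is strictly better than x0, so y differs from x0; the mirror image
2 x0 - y is optimal too and has the same value of phi, which yields a second
equilibrium on the same horizon.

The analytic core is that straight lines minimize the action among absolutely
continuous curves, whose derivative exists only almost everywhere
([energy_ge]). This rests on the fundamental theorem of calculus for absolutely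
continuous functions ([absolutely_continuous_derive1]): such a function is a
difference of two nondecreasing absolutely continuous functions, the
Lebesgue-Stieltjes measure of each is dominated by Lebesgue measure, and the
Radon-Nikodym densities are the derivatives by Lebesgue's differentiation
theorem. *)

Set Implicit Arguments.
Unset Strict Implicit.
Unset Printing Implicit Defensive.

Import Order.TTheory GRing.Theory Num.Theory.
Import numFieldTopology.Exports numFieldNormedType.Exports.
Local Open Scope classical_set_scope.
Local Open Scope ring_scope.

Local Notation kinetic R :=
  (fun _ v : R => 2^-1 * `|v| ^+ 2) (only parsing).
Local Notation separable_cost phi :=
  (fun (x : _) (m : probability _ _) => phi x * sigma_T phi m) (only parsing).

(** * Absolute continuity along finite families of intervals *)

Definition separated (R : realType) (p q : R * R) : bool :=
  (p.2 <= q.1) || (q.2 <= p.1).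

Definition nonoverlapping (R : realType) (s : seq (R * R)) : bool :=
  all (fun p => p.1 <= p.2) s && pairwise (@separated R) s.

Definition total_length (R : realType) (s : seq (R * R)) : R :=
  \sum_(p <- s) (p.2 - p.1).

Definition total_increment (R : realType) (F : R -> R) (s : seq (R * R)) : R :=
  \sum_(p <- s) `|F p.2 - F p.1|.

(** Absolute continuity on the whole line, with families given as lists rather
than as indexed families: lists can be concatenated and refined by induction.
Degenerate intervals and a non-strict final bound are allowed so that the
notion is stable under clipping and under suprema. *)
Definition AC (R : realType) (F : R -> R) : Prop :=
  forall e : R, 0 < e -> exists2 d : R, 0 < d &
    forall s, nonoverlapping s -> total_length s < d ->
      total_increment F s <= e.

Definition clip (R : realType) (a b x : R) : R := Num.max a (Num.min b x).

Lemma le_clip (R : realType) (a b x y : R) : x <= y -> clip a b x <= clip a b y.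
Proof.
by move=> xy; rewrite /clip; case: (leP b x) => ?; case: (leP b y) => ?;
  case: (leP a b) => ?; case: (leP a x) => ?; case: (leP a y) => ?; lra.
Qed.

Lemma clip_itv (R : realType) (a b x : R) : a <= b -> a <= clip a b x <= b.
Proof. by move=> ab; rewrite /clip le_max lexx /= ge_max ab ge_min lexx. Qed.

Lemma clip_id (R : realType) (a b x : R) : a <= x -> x <= b -> clip a b x = x.
Proof. by move=> ax xb; rewrite /clip min_r// max_r. Qed.

Lemma clip_lipschitz (R : realType) (a b x y : R) : x <= y ->
  clip a b y - clip a b x <= y - x.
Proof.
by move=> xy; rewrite /clip; case: (leP b x) => ?; case: (leP b y) => ?;
  case: (leP a b) => ?; case: (leP a x) => ?; case: (leP a y) => ?; lra.
Qed.

Lemma nonoverlapping_map (R : realType) (k : R -> R) s :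
  {homo k : x y / x <= y} -> nonoverlapping s ->
  nonoverlapping [seq (k p.1, k p.2) | p <- s].
Proof.
move=> kh /andP[s1 s2]; apply/andP; split.
  by rewrite all_map; apply: sub_all s1 => p /= /kh.
rewrite pairwise_map; apply: sub_pairwise s2 => p q /=.
by rewrite /separated /= => /orP[/kh ->|/kh ->]; rewrite ?orbT.
Qed.

Lemma total_length_map (R : realType) (k : R -> R) s :
  (forall x y, x <= y -> k y - k x <= y - x) -> nonoverlapping s ->
  total_length [seq (k p.1, k p.2) | p <- s] <= total_length s.
Proof.
move=> kl sn; rewrite /total_length big_map big_seq [leRHS]big_seq.
by apply: ler_sum => p ps; apply: kl; case/andP: sn => /allP/(_ p ps).
Qed.

(** Clipping transports a family of intervals of the line into [a, b] without
increasing lengths; the intervals that it collapses carry no increment and are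
filtered out before the strict definition is used. *)
Lemma absolutely_continuous_on_AC (R : realType) (a b : R) (F : R -> R) :
  a <= b -> absolutely_continuous_on a b F -> AC (F \o clip a b).
Proof.
move=> ab acF e /acF[d d0 dP]; exists d => // s sn sd.
set s' := [seq (clip a b p.1, clip a b p.2) | p <- s].
have s'n : nonoverlapping s' := nonoverlapping_map (@le_clip _ a b) sn.
have s'd : total_length s' < d.
  by apply: le_lt_trans sd; apply: total_length_map sn; exact: clip_lipschitz.
have s'ab p : p \in s' -> a <= p.1 /\ p.2 <= b.
  move=> /mapP[q _ ->] /=.
  by split; case/andP: (clip_itv q.1 ab); case/andP: (clip_itv q.2 ab).
have -> : total_increment (F \o clip a b) s = total_increment F s'.
  by rewrite /total_increment big_map.
set t := [seq p <- s' | p.1 < p.2].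
have -> : total_increment F s' = total_increment F t.
  rewrite /total_increment big_filter [RHS]big_mkcond big_seq [RHS]big_seq.
  apply: eq_bigr => p ps; case: ifPn => //; rewrite -leNgt => pp.
  case/andP: s'n => /allP/(_ p ps) pp' _.
  suff -> : p.2 = p.1 by rewrite subrr normr0.
  by apply/eqP; rewrite eq_le pp pp'.
have td : total_length t < d.
  apply: le_lt_trans s'd; rewrite /total_length big_filter big_mkcond.
  rewrite big_seq [leRHS]big_seq; apply: ler_sum => p ps.
  case: ifPn => // _; case/andP: s'n => /allP/(_ p ps) pp' _.
  by rewrite subr_ge0.
have pt : pairwise (@separated R) t.
  by case/andP: s'n => _; exact/subseq_pairwise/filter_subseq.
have tn (i : 'I_(size t)) : nth (0, 0) t i \in t by exact: mem_nth.
rewrite /total_increment (big_nth (0, 0)) big_mkord; apply/ltW.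
apply: (dP (size t) (fun i => (nth (0, 0) t i).1)
  (fun i => (nth (0, 0) t i).2)).
- move=> i; have := tn i; rewrite mem_filter => /andP[h /s'ab[? ?]].
  by split.
- apply/trivIsetP => i j _ _ ij.
  have : separated (nth (0, 0) t i) (nth (0, 0) t j).
    move/(pairwiseP (0, 0)) : pt => pt.
    have [ltij|ltji|/val_inj eij] := ltngtP i j.
    - by apply: pt => //; rewrite inE.
    - by rewrite /separated orbC; apply: pt => //; rewrite inE.
    - by rewrite eij eqxx in ij.
  move=> h; apply/seteqP; split => // x [] /=; rewrite !in_itv /=.
  move=> /andP[h1 h2] /andP[h3 h4]; move/orP: h => []; lra.
- by move: td; rewrite /total_length (big_nth (0, 0)) big_mkord.
Qed.

Lemma max_homo (R : realType) (a : R) : {homo Num.max a : x y / x <= y}.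
Proof. by move=> x y xy; case: (leP a x); case: (leP a y); lra. Qed.

Lemma max_lipschitz (R : realType) (a x y : R) : x <= y ->
  Num.max a y - Num.max a x <= y - x.
Proof. by move=> xy; case: (leP a x); case: (leP a y); lra. Qed.

Lemma AC_comp (R : realType) (F k : R -> R) : {homo k : x y / x <= y} ->
  (forall x y, x <= y -> k y - k x <= y - x) -> AC F -> AC (F \o k).
Proof.
move=> kh kl ACF e /ACF[d d0 dP]; exists d => // s sn sd.
have := dP _ (nonoverlapping_map kh sn).
rewrite /total_increment big_map; apply.
by apply: le_lt_trans sd; exact: total_length_map.
Qed.

Lemma AC_sub (R : realType) (F G : R -> R) : AC F -> AC G -> AC (F \- G).
Proof.
move=> ACF ACG e e0.
have [d1 d10 H1] := ACF _ (divr_gt0 e0 (ltr0Sn R 1)).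
have [d2 d20 H2] := ACG _ (divr_gt0 e0 (ltr0Sn R 1)).
exists (Num.min d1 d2); first by rewrite lt_min d10.
move=> s sn; rewrite lt_min => /andP[/(H1 _ sn) h1 /(H2 _ sn) h2].
rewrite [leRHS]splitr; apply: le_trans (lerD h1 h2).
rewrite /total_increment -big_split /=; apply: ler_sum => p _ /=.
have -> : (F \- G) p.2 - (F \- G) p.1 = (F p.2 - F p.1) - (G p.2 - G p.1).
  by rewrite /GRing.sub_fun; lra.
exact: ler_normB.
Qed.

Lemma AC_continuous (R : realType) (F : R -> R) : AC F -> continuous F.
Proof.
move=> ACF x; apply/cvgrPdist_le => e /ACF[d d0 dP]; near=> y.
have : `|x - y| < d by near: y; exact: cvgr_dist_lt.
case: (leP x y) => xy xyd.
  have := dP [:: (x, y)].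
  rewrite /nonoverlapping /= xy /total_length /total_increment.
  rewrite !big_seq1/= distrC.
  by apply => //; move: xyd; rewrite distrC ger0_norm ?subr_ge0.
have := dP [:: (y, x)].
rewrite /nonoverlapping /= ltW// /total_length /total_increment !big_seq1/=.
by apply => //; move: xyd; rewrite ger0_norm ?subr_ge0// ltW.
Unshelve. all: by end_near. Qed.

(** * Total variation of an absolutely continuous function *)

Lemma subdivision_bounds (R : realType) (a : R) u : path <%O a u ->
  forall p, p \in pairmap pair a u ->
    [/\ a <= p.1, p.1 <= p.2 & p.2 <= last a u].
Proof.
elim: u a => // x u IH a /= /andP[ax xu] p; rewrite inE => /predU1P[->|/IH] /=.
  split => //=; first exact: ltW.
  by apply: (@itv_partition_le _ _ _ _ u); split.
by move=> /(_ xu)[xp pp pl]; split => //; rewrite (le_trans _ xp)// ltW.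
Qed.

Lemma subdivision_pairwise (R : realType) (a : R) u : path <%O a u ->
  pairwise (@separated R) (pairmap pair a u).
Proof.
elim: u a => // x u IH a /= /andP[ax xu]; rewrite IH// andbT.
apply/allP => p /(subdivision_bounds xu)[xp _ _].
by rewrite /separated /= xp.
Qed.

Lemma subdivision_length (R : realType) (a : R) u :
  total_length (pairmap pair a u) = last a u - a.
Proof.
elim: u a => [a|x u IH a]; first by rewrite /total_length big_nil subrr.
by rewrite /total_length /= big_cons -/(total_length _) IH /=; lra.
Qed.

Lemma subdivision_increment (R : realType) (F : R -> R) (a b : R) u :
  itv_partition a b u ->
  total_increment F (pairmap pair a u) = variation a b F u.
Proof.
move=> abu; rewrite variation_zip// /total_increment.
elim: u a {abu} => [a|x u IH a]; first by rewrite !big_nil.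
by rewrite /= !big_cons IH.
Qed.

Lemma total_variation_approx (R : realType) (F : R -> R) (a b e : R) :
  a <= b -> 0 < e -> total_variation a b F \is a fin_num ->
  exists2 u, itv_partition a b u &
    fine (total_variation a b F) <= variation a b F u + e.
Proof.
rewrite le_eqVlt => /predU1P[<-|ab] e0 fF.
  exists [::]; first by split.
  by rewrite total_variationxx /variation big_nil add0r ltW.
have [_ [_ [u abu <-] <-]] := ub_ereal_sup_adherent e0 fF.
move=> h; exists u => //; rewrite -lee_fin EFinD fineK//.
by rewrite -leeBlDr//; exact: ltW.
Qed.

(** The total variations over the members of a family are approximated all at
once by the increments over one finer family of the same total length: this is
what turns a bound on increments into a bound on variations. *)
Lemma total_variation_refine (R : realType) (F : R -> R) :
  (forall a b, a <= b -> total_variation a b F \is a fin_num) ->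
  forall s e, nonoverlapping s -> 0 < e -> exists t,
  [/\ nonoverlapping t, total_length t = total_length s,
      \sum_(p <- s) fine (total_variation p.1 p.2 F) <=
        total_increment F t + e &
      forall q, q \in t -> exists2 p, p \in s & p.1 <= q.1 /\ q.2 <= p.2].
Proof.
move=> fF; elim => [|[l r] s IH] e sn e0.
  exists [::]; split => //.
  by rewrite /total_increment !big_nil add0r ltW.
move: sn => /= /andP[/= /andP[lr s1] /andP[lrs s2]].
have e20 : 0 < e / 2 by rewrite divr_gt0.
have [||t [tn tl tF ts]] := IH (e / 2) => //; first exact/andP.
have [u [lu /eqP ur] uF] := total_variation_approx lr e20 (fF _ _ lr).
have ub p (pu : p \in pairmap pair l u) := subdivision_bounds lu pu.
exists (pairmap pair l u ++ t); split.
- case/andP: tn => t1 t2; apply/andP; split.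
    by rewrite all_cat t1 andbT; apply/allP => p /ub[].
  rewrite pairwise_cat t2 subdivision_pairwise// !andbT.
  apply/allrelP => p q /ub[lp pp]; rewrite ur => pr /ts[q' q's [q1 q2]].
  have /= := allP lrs _ q's; rewrite /separated /= => /orP[h|h].
  + by rewrite (le_trans pr)// (le_trans h).
  + by rewrite (le_trans q2) ?orbT// (le_trans h).
- rewrite /total_length big_cat big_cons /= -/(total_length _).
  by rewrite subdivision_length ur -/(total_length t) tl.
- rewrite big_cons /total_increment big_cat /= -/(total_increment F t).
  rewrite -/(total_increment F _) (@subdivision_increment _ _ l r)//.
    by move: uF tF => /=; lra.
  by split => //; apply/eqP.
- move=> q; rewrite mem_cat => /orP[/ub[h1 h2 h3]|/ts[p ps ?]].
    by exists (l, r); rewrite ?mem_head//=; rewrite -ur.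
  by exists p => //; rewrite inE ps orbT.
Qed.

(** The variation is at most 1 on every interval shorter than the modulus of
absolute continuity at 1, and finitely many such intervals cover [a, b]. *)
Lemma AC_total_variation_fin (R : realType) (F : R -> R) (a b : R) :
  AC F -> a <= b -> total_variation a b F \is a fin_num.
Proof.
move=> ACF; have [d d0 dP] := ACF 1 ltr01.
have small x y : x <= y -> y - x < d -> total_variation x y F \is a fin_num.
  move=> xy xyd; rewrite ge0_fin_numE; last exact: total_variation_ge0.
  apply: (@le_lt_trans _ _ 1%:E); last exact: ltry.
  apply: ge_ereal_sup => _ [_ [u [xu /eqP uy] <-] <-].
  rewrite lee_fin -(@subdivision_increment _ _ x y u); last first.
    by split => //; apply/eqP.
  apply: dP; last by rewrite subdivision_length uy.
  rewrite /nonoverlapping subdivision_pairwise// andbT.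
  by apply/allP => p /(subdivision_bounds xu)[].
have d20 : 0 < d / 2 by rewrite divr_gt0.
have many n : total_variation a (a + n%:R * (d / 2)) F \is a fin_num.
  elim: n => [|n IH]; first by rewrite mul0r addr0 total_variationxx.
  have an : a <= a + n%:R * (d / 2) by rewrite lerDl mulr_ge0// ltW.
  rewrite (@total_variationD _ _ _ (a + n%:R * (d / 2)))//.
    rewrite fin_numD IH small//.
      by rewrite lerD2l ler_wpM2r ?ler_nat// ltW.
    by rewrite -natr1; lra.
  by rewrite lerD2l ler_wpM2r ?ler_nat// ltW.
move=> ab; set n := Num.bound ((b - a) / (d / 2)).
have bn : b <= a + n%:R * (d / 2).
  have : (b - a) / (d / 2) < n%:R.
    by apply: le_lt_trans (archi_boundP _); rewrite ?divr_ge0 ?subr_ge0// ltW.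
  by rewrite ltr_pdivrMr//; lra.
have := many n; rewrite (@total_variationD _ _ _ b)// fin_numD.
by case/andP.
Qed.

(** The increasing part of the Jordan decomposition, made constant to the left
of a so that it is defined, and monotone, on the whole line. *)
Definition variation_from (R : realType) (a : R) (F : R -> R) (x : R) :=
  fine (total_variation a (Num.max a x) F).

Lemma variation_fromB (R : realType) (a : R) (F : R -> R) (x y : R) :
  AC F -> x <= y ->
  variation_from a F y - variation_from a F x =
  fine (total_variation (Num.max a x) (Num.max a y) F).
Proof.
move=> ACF xy.
have h1 : a <= Num.max a x by rewrite le_max lexx.
have h2 : Num.max a x <= Num.max a y by exact: max_homo.
rewrite /variation_from (total_variationD F h1 h2).
rewrite fineD ?AC_total_variation_fin//.
by rewrite addrAC subrr add0r.
Qed.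

(** Increments of the variation function are total variations, and by
refinement these are bounded by increments of F over a family of the same
length. *)
Lemma AC_variation_from (R : realType) (a : R) (F : R -> R) :
  AC F -> AC (variation_from a F).
Proof.
move=> ACF e e0; have e20 : 0 < e / 2 by rewrite divr_gt0.
have [d d0 dP] := ACF _ e20; exists d => // s sn sd.
pose k := Num.max a.
have kh : {homo k : x y / x <= y} := @max_homo R a.
have kl x y : x <= y -> k y - k x <= y - x := @max_lipschitz R a x y.
have fF a' b' := @AC_total_variation_fin R F a' b' ACF.
have [t [tn tl tF _]] :=
  total_variation_refine fF (nonoverlapping_map kh sn) e20.
have := dP _ tn; rewrite tl.
move=> /(_ (le_lt_trans (total_length_map kl sn) sd)) tFe.
have : \sum_(p <- [seq (k p.1, k p.2) | p <- s])
    fine (total_variation p.1 p.2 F) <= e by move: tF tFe; lra.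
apply: le_trans; rewrite /total_increment big_map big_seq [leRHS]big_seq.
apply: ler_sum => p ps; have pp : p.1 <= p.2 by case/andP: sn => /allP/(_ p ps).
rewrite variation_fromB// ger0_norm// fine_ge0// total_variation_ge0//.
exact: kh.
Qed.

(** * Density of an absolutely continuous function *)

Lemma stieltjes_itv_oc (R : realType) (F : cumulative R R) (a b : R) :
  a <= b -> lebesgue_stieltjes_measure F `]a, b]%classic = (F b - F a)%:E.
Proof.
move=> ab; rewrite /lebesgue_stieltjes_measure /measure_extension.
rewrite measurable_mu_extE/=; last exact: is_ocitv.
by rewrite wlength_itv_bnd.
Qed.

Lemma open_interval_bounded (R : realType) (I : set R) :
  open I -> is_interval I -> has_lbound I -> has_ubound I ->
  I = `]inf I, sup I[%classic.
Proof.
move=> oI iI lI uI; rewrite -[LHS](interior_id I).1//.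
by rewrite interval_bounded_interior.
Qed.

(** An open set is a countable disjoint union of open intervals; every finite
subfamily of these is nonoverlapping and shorter than d, hence has Stieltjes
mass at most e, and the series inherits the bound. Boundedness of U makes the
endpoints of the intervals real numbers. *)
Lemma stieltjes_open_le (R : realType) (F : cumulative R R) (e d a b : R) :
  (forall s, nonoverlapping s -> total_length s < d ->
     total_increment F s <= e) ->
  forall U : set R, open U -> U `<=` `]a, b[ -> (lebesgue_measure U < d%:E)%E ->
  (lebesgue_stieltjes_measure F U <= e%:E)%E.
Proof.
move=> Fed U oU Uab Ud.
pose I := open_disjoint_itv oU.
have UI : U = \bigcup_q I q by exact: open_disjoint_itv_bigcup.
have IU q : I q `<=` U by rewrite UI; exact: bigcup_sup.
have lI q : has_lbound (I q).
  by exists a => x /IU /Uab; rewrite /= in_itv/= => /andP[/ltW].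
have uI q : has_ubound (I q).
  by exists b => x /IU /Uab; rewrite /= in_itv/= => /andP[_ /ltW].
have IE q : I q = `]inf (I q), sup (I q)[%classic.
  apply: open_interval_bounded => //; first exact: open_disjoint_itv_open.
  exact: open_disjoint_itv_is_interval.
have Iin q x : inf (I q) < x < sup (I q) -> I q x.
  by move=> h; rewrite IE /= in_itv.
have mI q : measurable (I q : set (measurableTypeR R)).
  by rewrite IE; exact: measurable_itv.
have tI : trivIset setT I by exact: open_disjoint_itv_trivIset.
pose P q := inf (I q) < sup (I q).
have IP q : ~~ P q -> I q = set0.
  by move=> Pq; rewrite IE set_itv_ge// bnd_simp.
have lamI q : P q -> lebesgue_measure (I q) = (sup (I q) - inf (I q))%:E.
  by move=> Pq; rewrite {1}IE lebesgue_measure_itv/= lte_fin ifT ?EFinB.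
have FI q : P q -> (lebesgue_stieltjes_measure F (I q) <=
    `|F (sup (I q)) - F (inf (I q))|%:E)%E.
  move=> Pq; rewrite {1}IE; apply: (@le_trans _ _
    (lebesgue_stieltjes_measure F `]inf (I q), sup (I q)]%classic)).
    apply: le_measure; rewrite ?inE; [exact: measurable_itv..|].
    by apply: subset_itvl; rewrite bnd_simp.
  by rewrite stieltjes_itv_oc ?lee_fin ?ler_norm// ltW.
pose s n := [seq (inf (I q), sup (I q)) | q <- iota 0 n & P q].
have sn n : nonoverlapping (s n).
  rewrite /nonoverlapping; apply/andP; split.
    by apply/allP => p /mapP[q]; rewrite mem_filter => /andP[/ltW ? _] ->.
  rewrite pairwise_map.
  have : pairwise (fun p q => p != q) [seq q <- iota 0 n | P q].
    by rewrite -uniq_pairwise filter_uniq ?iota_uniq.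
  apply: (@sub_in_pairwise _ [pred q | P q]); last first.
    by apply/allP => q; rewrite mem_filter => /andP[].
  move=> p q /= Pp Pq pq.
  rewrite /separated/= leNgt (leNgt (sup (I q))) -negb_and.
  apply/negP => /andP[qp pq'].
  (* two overlapping intervals share the midpoint of their intersection *)
  have : (I p `&` I q) ((Num.max (inf (I p)) (inf (I q)) +
                         Num.min (sup (I p)) (sup (I q))) / 2).
    move: Pp Pq pq'; rewrite /P !inE => Pp Pq pq'.
    split; apply: Iin;
      move: (inf (I p)) (sup (I p)) (inf (I q)) (sup (I q)) Pp Pq pq' qp;
      move=> a1 b1 a2 b2.
      by case: (leP a1 a2); case: (leP b1 b2); lra.
    by case: (leP a1 a2); case: (leP b1 b2); lra.
  by move/trivIsetP : tI => ->.
have sumP (G : nat -> \bar R) n : (forall q, ~~ P q -> G q = 0%E) ->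
    (\sum_(0 <= q < n) G q = \sum_(q <- [seq q <- iota 0 n | P q]) G q)%E.
  move=> G0; rewrite /index_iota subn0 big_filter [RHS]big_mkcond.
  apply: eq_bigr => q _.
  by case: ifPn => // /G0.
have sd n : total_length (s n) < d.
  rewrite -lte_fin; apply: le_lt_trans Ud.
  rewrite [in leRHS]UI measure_bigcup//.
  apply: (@le_trans _ _ (\sum_(0 <= q < n) lebesgue_measure (I q))%E).
    rewrite sumP; last by move=> q /IP ->; exact: measure0.
    rewrite /total_length /s big_map -sumEFin big_filter [leRHS]big_filter.
    by apply: lee_sum => q Pq; rewrite lamI.
  rewrite (eq_eseriesl (P := fun x => x \in setT) (Q := xpredT)); last first.
    by move=> q; rewrite in_setT.
  by apply: nneseries_lim_ge => q _ _; exact: measure_ge0.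
rewrite UI measure_bigcup//.
rewrite (eq_eseriesl (P := fun x => x \in setT) (Q := xpredT)); last first.
  by move=> q; rewrite in_setT.
apply: lime_le.
  by apply: is_cvg_ereal_nneg_natsum => q _; exact: measure_ge0.
near=> n.
rewrite sumP; last by move=> q /IP ->; exact: measure0.
apply: (@le_trans _ _ (total_increment F (s n))%:E); last first.
  by rewrite lee_fin; exact: Fed.
rewrite /total_increment /s big_map -sumEFin big_filter [leRHS]big_filter.
by apply: lee_sum => q Pq; exact: FI.
Unshelve. all: by end_near. Qed.

(** Outer regularity encloses a Lebesgue null set in open sets of arbitrarily
small length, whose Stieltjes mass is arbitrarily small. *)
Lemma AC_stieltjes_dominated (R : realType) (F : cumulative R R) (a b : R)
    (N : set (measurableTypeR R)) :
  AC F -> measurable N -> N `<=` `]a, b] -> lebesgue_measure N = 0 ->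
  lebesgue_stieltjes_measure F N = 0.
Proof.
move=> ACF mN Nab N0; apply/eqP; rewrite eq_le measure_ge0 andbT.
apply/lee_addgt0Pr => e /ACF[d d0 dP]; rewrite add0e.
have [|U [oU NU Ud]] := @lebesgue_regularity_outer _ N d mN _ d0.
  by apply: (@le_lt_trans _ _ 0%E); [rewrite -N0|exact: ltry].
pose V : set R := U `&` `]a - 1, b + 1[.
have mU : measurable (U : set (measurableTypeR R)) by exact: open_measurable.
have oV : open V by apply: openI => //; exact: interval_open.
have mV : measurable (V : set (measurableTypeR R)) by exact: open_measurable.
apply: (@le_trans _ _ (lebesgue_stieltjes_measure F V)).
  apply: le_measure; rewrite ?inE//.
  move=> x Nx; split; first exact: NU.
  have := Nab x Nx; rewrite /= !in_itv/= => /andP[? ?].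
  by apply/andP; split; lra.
apply: (stieltjes_open_le dP oV (@subIsetr _ _ _)).
apply: le_lt_trans Ud; apply: (@le_trans _ _ (lebesgue_measure U)).
  by apply: le_measure; rewrite ?inE//; exact: subIsetl.
rewrite -{1}(setDUK NU) measureU//; last 2 first.
- exact: measurableD.
- by rewrite setDIK.
by rewrite [X in (X + _)%E](_ : _ = 0%E) ?add0e.
Qed.

(** Radon-Nikodym theorem for the Stieltjes measure of F restricted to ]a, b]. *)
Lemma AC_nondecreasing_density (R : realType) (F : R -> R) (a b : R) :
  a <= b -> nondecreasing F -> AC F ->
  exists f : R -> R, lebesgue_measure.-integrable setT (EFin \o f) /\
    forall x, a <= x <= b ->
      F x - F a = \int[lebesgue_measure]_(t in `]a, x]) f t.
Proof.
move=> ab ndF ACF.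
have rcF : right_continuous F by exact/right_continuousW/AC_continuous.
pose C : cumulative R R := HB.pack F (isCumulative.Build _ _ _ F ndF rcF).
pose mu := lebesgue_stieltjes_measure C.
have mD : measurable (`]a, b]%classic : set (measurableTypeR R)).
  exact: measurable_itv.
have muD : (mu `]a, b]%classic < +oo)%E by rewrite /mu stieltjes_itv_oc ?ltry.
pose nu : {finite_measure set (measurableTypeR R) -> \bar R} := mfrestr mD muD.
have dom : nu `<< (@lebesgue_measure R).
  apply/null_content_dominatesP => A mA A0.
  apply: (@AC_stieltjes_dominated _ C a b) => //; first exact: measurableI.
  apply/eqP; rewrite eq_le measure_ge0 andbT -A0.
  by apply: le_measure; rewrite ?inE//; exact: measurableI.
have [f [f0 ffin fint fE]] := radon_nikodym_sigma_finite dom.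
have fK : EFin \o (fine \o f) = f by apply/funext => x /=; rewrite fineK.
exists (fine \o f); split; first by rewrite fK.
move=> x /andP[ax xb]; rewrite /Rintegral.
rewrite (_ : (fun t => ((fine \o f) t)%:E) = f); last exact: fK.
rewrite -fE; last exact: measurable_itv.
rewrite /nu /= /mfrestr /mrestr setIidl; last first.
  by apply: subset_itvl; rewrite bnd_simp.
by rewrite stieltjes_itv_oc.
Qed.

(** On [a, b], F is the difference of its variation function V and of V - F; both
are nondecreasing and absolutely continuous, so each has a density. *)
Lemma AC_density (R : realType) (F : R -> R) (a b : R) :
  a <= b -> AC F ->
  exists f : R -> R, lebesgue_measure.-integrable setT (EFin \o f) /\
    forall x, a <= x <= b ->
      F x - F a = \int[lebesgue_measure]_(t in `]a, x]) f t.
Proof.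
move=> ab ACF; pose V := variation_from a F.
pose k := Num.max a.
have kh : {homo k : x y / x <= y} := @max_homo R a.
have kl x y : x <= y -> k y - k x <= y - x := @max_lipschitz R a x y.
have ACV : AC V by exact: AC_variation_from.
have ACW : AC (V \- (F \o k)) by apply: AC_sub => //; exact: AC_comp.
have ndV : nondecreasing V.
  move=> x y xy; rewrite -subr_ge0 variation_fromB// fine_ge0//.
  by rewrite total_variation_ge0//; exact: kh.
have ndW : nondecreasing (V \- (F \o k)).
  move=> x y xy.
  suff : F (k y) - F (k x) <= V y - V x by rewrite /GRing.sub_fun /=; lra.
  rewrite variation_fromB// -lee_fin fineK.
    apply: le_trans (total_variation_ge F (kh _ _ xy)).
    by rewrite lee_fin ler_norm.
  by apply: AC_total_variation_fin => //; exact: kh.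
have [f [fi fE]] := AC_nondecreasing_density ab ndV ACV.
have [g [gi gE]] := AC_nondecreasing_density ab ndW ACW.
exists (f \- g); split.
  exact: (@integrableB _ _ _ lebesgue_measure _ _ _ _ fi gi).
move=> x axb; have ax : a <= x by case/andP: axb.
rewrite RintegralB//; last 2 first.
- exact: (integrableS measurableT).
- exact: (integrableS measurableT).
rewrite -fE// -gE// /GRing.sub_fun /= /k max_r// max_l//; lra.
Qed.

(** Lebesgue's form of the fundamental theorem of calculus: g is an indefinite
integral by the previous lemma, and indefinite integrals are differentiable at
almost every point, with the integrand as derivative. *)
Lemma absolutely_continuous_derive1 (R : realType) (g : R -> R) (a b : R) :
  a <= b -> absolutely_continuous_on a b g ->
  exists f : R -> R, [/\ lebesgue_measure.-integrable setT (EFin \o f),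
    g b - g a = \int[lebesgue_measure]_(t in `]a, b]) f t &
    {ae lebesgue_measure, forall x, a < x < b -> derive1 g x = f x}].
Proof.
move=> ab /(absolutely_continuous_on_AC ab) ACg.
have [f [fi fE]] := AC_density ab ACg.
have gk x : a <= x <= b ->
    g x - g a = \int[lebesgue_measure]_(t in `]a, x]) f t.
  by move=> /[dup] /andP[ax xb] /fE <- /=; rewrite !clip_id.
exists f; split => //; first by rewrite gk// ab lexx.
have := @FTC1 _ f (BRight a).
have fiS y : lebesgue_measure.-integrable
    [set` Interval (BRight a) (BRight y)] (EFin \o f).
  exact: (integrableS measurableT).
move=> /(_ fiS) /(_ (open_integrable_locally openT fi)).
apply: filterS; first exact: (ae_filter_ringOfSetsType lebesgue_measure).
move=> x /= H /andP[ax xb].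
have ax' : (BRight a < BRight x)%O by rewrite bnd_simp.
have [dG <-] := H ax'.
set G := (fun y => \int[lebesgue_measure]_(t in `]a, y]) f t) in dG *.
rewrite !derive1E (_ : 'D_1 G x = 'D_1 (cst (g a) \+ G) x); last first.
  by rewrite deriveD// derive_cst add0r.
apply: near_eq_derive; near=> y; rewrite /= /G -gk.
  by rewrite addrC subrK.
by apply/andP; split; apply/ltW; near: y; [exact: lt_nbhsr|exact: lt_nbhsl].
Unshelve. all: by end_near. Qed.

(** * The action of a curve *)

(** The integral of a nonnegative function is a supremum over simple functions
below it, so it is monotone even for functions that are not measurable. This is
how one gets around the arbitrary values taken by the derivative of a curve
where the curve is not differentiable. *)
Lemma le_lower_integral d (T : measurableType d) (R : realType)
    (mu : {measure set T -> \bar R}) (A B : set T) (f g : T -> \bar R) :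
  A `<=` B -> (forall x, A x -> 0 <= f x)%E -> (forall x, B x -> 0 <= g x)%E ->
  (forall x, A x -> f x <= g x)%E ->
  (\int[mu]_(x in A) f x <= \int[mu]_(x in B) g x)%E.
Proof.
move=> AB f0 g0 fg; rewrite !ge0_integralE//.
apply: le_ereal_sup => _ [h hf <-]; exists h => // x.
apply: le_trans (hf x) _; rewrite !patchE.
case: ifPn => [/set_mem Ax|_]; first by rewrite mem_set ?fg//; exact: AB.
by case: ifPn => // /set_mem; exact: g0.
Qed.

(** Straight lines minimize the kinetic action. With c the mean slope,
1/2 p ^ 2 >= c p - 1/2 c ^ 2 for every p; applied to the slope of g, which is
almost everywhere the density f, the right-hand side integrates to
c (g b - g a) - 1/2 c ^ 2 (b - a), which is the left-hand side of the
inequality. *)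
Lemma energy_ge (R : realType) (g : R -> R) (a b : R) :
  a < b -> absolutely_continuous_on a b g ->
  (((g b - g a) ^+ 2 / (2 * (b - a)))%:E <=
    \int[lebesgue_measure]_(s in `[a, b]) (2^-1 * `|derive1 g s| ^+ 2)%:E)%E.
Proof.
move=> ab /(absolutely_continuous_derive1 (ltW ab))[f [fi fE [N [mN N0 fN]]]].
set c := (g b - g a) / (b - a).
have ba : b - a != 0 by rewrite subr_eq0 gt_eqF.
(* the affine minorant of t |-> 1/2 (f t) ^ 2, tangent at slope c *)
pose k t := c * f t - c ^+ 2 / 2.
pose E : set R := `]a, b]%classic.
have mE : measurable (E : set (measurableTypeR R)) by exact: measurable_itv.
have fiE : lebesgue_measure.-integrable E (EFin \o f).
  exact: (integrableS measurableT).
have cE : lebesgue_measure.-integrable E (EFin \o cst (c ^+ 2 / 2)).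
  apply/integrableP; split.
    by apply/measurable_EFinP; exact: measurable_cst.
  apply: (@le_lt_trans _ _ (`|c ^+ 2 / 2|%:E * lebesgue_measure E)%E).
    by rewrite -integral_cst.
  by rewrite lebesgue_measure_itv/= lte_fin ab -EFinB -EFinM ltry.
have cfE : lebesgue_measure.-integrable E (EFin \o (fun t => c * f t)).
  exact: (integrableZl mE c fiE).
have kE : lebesgue_measure.-integrable E (EFin \o k).
  exact: (@integrableB _ _ _ lebesgue_measure _ _ _ _ cfE cE).
have -> : (g b - g a) ^+ 2 / (2 * (b - a)) =
    \int[lebesgue_measure]_(t in E) k t.
  rewrite /k RintegralB// RintegralZl// -fE Rintegral_cst//.
  have -> : fine (lebesgue_measure E) = b - a.
    by rewrite /E lebesgue_measure_itv/= lte_fin ab.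
  rewrite /c.
  by field.
rewrite /Rintegral fineK; last exact: integrable_fin_num.
(* b itself is discarded, since f is compared with the derivative on ]a, b[ *)
pose M := N `|` [set b].
have mM : measurable (M : set (measurableTypeR R)) by exact: measurableU.
have M0 : lebesgue_measure M = 0.
  apply/eqP; rewrite eq_le measure_ge0 andbT.
  apply: le_trans (measureU2 _ mN (measurable_set1 b)) _.
  rewrite -[leRHS]adde0 leeD//; first by rewrite -N0.
  rewrite le_eqVlt; apply/orP; left; apply/eqP.
  exact: lebesgue_measure_set1.
rewrite (negligible_integral mM mE kE M0).
have mEM : measurable (E `\` M : set (measurableTypeR R)) by exact: measurableD.
have kEM : lebesgue_measure.-integrable (E `\` M) (EFin \o k).
  by apply: integrableS kE => //; exact: subDsetl.
apply: (@le_trans _ _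
  (\int[lebesgue_measure]_(x in E `\` M) (EFin \o k)^\+ x)%E).
  apply: le_integral => //; first exact: integrable_funepos.
  by move=> x _; rewrite funeposE le_max lexx.
apply: le_lower_integral.
- by move=> x [+ _]; rewrite /E /= !in_itv/= => /andP[/ltW -> ->].
- by move=> x _; rewrite funeposE le_max lexx orbT.
- by move=> x _; rewrite lee_fin mulr_ge0// exprn_ge0.
- move=> x [Ex Mx]; have -> : derive1 g x = f x.
    apply: contrapT => gf; apply: Mx.
    have [xb|xb] := eqVneq x b; first by right.
    left; apply: fN => /= H; apply: gf; apply: H.
    by move: Ex; rewrite /E /= in_itv/= => /andP[-> xleb]; rewrite lt_neqAle xb.
  rewrite funeposE ge_max !lee_fin /k real_normK ?num_real//.
  apply/andP; split; last by rewrite mulr_ge0 ?sqr_ge0.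
  have := sqr_ge0 (f x - c); lra.
Qed.

(** * Topological support of a measure on curves *)

(** Curves that stay close to a step function with rational values. The data
(n, q, k) are the number of steps, the list of values and an integer that fixes
the radius 1 / (k + 1); as they range over a countable type, the tubes play the
role of a countable base of the topology of uniform convergence, although they
need be neither open nor measurable. *)
Definition step_tube (R : realType) (T : {posnum R}) (c : nat * seq rat * nat) :
    set (curve T) :=
  [set g | forall t, 0 <= t <= T%:num ->
    `|g t - ratr (nth 0%Q c.1.2 (Num.truncn (t / (T%:num / c.1.1%:R))))|
      < c.2.+1%:R^-1].

Lemma curve_uniformly_continuous (R : realType) (T : {posnum R}) (g : curve T)
    (e : R) : 0 < e -> exists2 d : R, 0 < d &
  forall s t : R, 0 <= s -> s <= t -> t <= T%:num -> t - s < d ->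
    `|g t - g s| < e.
Proof.
move=> e0; have [acg _ _] : @curve_set R T (set_val g) by apply: set_valP.
have [d d0 dP] := acg e e0; exists d => // s t s0.
rewrite le_eqVlt => /predU1P[<-|st tT std].
  by move=> _ _; rewrite subrr normr0.
have := dP 1 (fun=> s) (fun=> t); rewrite !big_ord1; apply => //.
by apply/trivIsetP => i j _ _; rewrite !ord1 eqxx.
Qed.

Lemma rat_approx (R : realType) (x e : R) :
  0 < e -> exists q : rat, `|x - ratr q| < e.
Proof.
move=> e0; have /rat_in_itvoo[q] : x - e < x + e by lra.
rewrite in_itv/= => /andP[h1 h2]; exists q.
by rewrite ltr_norml; apply/andP; split; lra.
Qed.

Lemma step_tube_approx (R : realType) (T : {posnum R}) (g : curve T) (e : R) :
  0 < e -> exists c, step_tube c g /\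
    forall h : curve T, step_tube c h ->
      forall t, 0 <= t <= T%:num -> `|g t - h t| < e.
Proof.
move=> e0.
pose k := Num.bound (2 / e).
have ke : k.+1%:R^-1 < e / 2.
  rewrite -[e / 2]invrK ltf_pV2 ?posrE// ?invr_gt0 ?divr_gt0// invf_div.
  have : 2 / e < k%:R.
    by apply: le_lt_trans (archi_boundP _) => //; rewrite divr_ge0// ltW.
  by move=> /lt_trans; apply; rewrite ltr_nat.
have k0 : 0 < k.+1%:R^-1 / 2 :> R by rewrite divr_gt0// invr_gt0.
have [d d0 dP] := curve_uniformly_continuous g k0.
(* enough steps for g to vary by less than half a radius on each *)
pose n := (Num.bound (T%:num / d)).+1.
pose h : R := T%:num / n%:R.
have h0 : 0 < h by rewrite divr_gt0// ltr0n.
have hd : h < d.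
  rewrite ltr_pdivrMr ?ltr0n// mulrC -ltr_pdivrMr//.
  apply: (@lt_trans _ _ (Num.bound (T%:num / d))%:R); last by rewrite ltr_nat.
  by apply: le_lt_trans (archi_boundP _) => //; rewrite divr_ge0// ltW.
have qex (i : nat) : exists q : rat, `|g (i%:R * h) - ratr q| < k.+1%:R^-1 / 2.
  exact: rat_approx.
(* n + 1 values, because the step number of the time T is n *)
pose q := [seq sval (cid (qex i)) | i <- iota 0 n.+1].
have qP i : (i <= n)%N -> `|g (i%:R * h) - ratr (nth 0%Q q i)| < k.+1%:R^-1 / 2.
  move=> ni; rewrite (nth_map 0%N) ?size_iota// nth_iota// add0n.
  exact: svalP (cid (qex i)).
have gc : step_tube (n, q, k) g.
  move=> t /andP[t0 tT] /=; rewrite -/h.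
  have th0 : 0 <= t / h by rewrite divr_ge0// ltW.
  have /andP[] := truncn_itv th0.
  set i := Num.Def.trunc _; rewrite ler_pdivlMr// ltr_pdivrMr// => it ti.
  have iN : (i <= n)%N.
    rewrite -(ler_nat R) -(ler_pM2r h0); apply: le_trans it (le_trans tT _).
    by rewrite /h mulrC divfK// pnatr_eq0.
  have gt : `|g t - g (i%:R * h)| < k.+1%:R^-1 / 2.
    apply: dP => //; first by rewrite mulr_ge0// ltW.
    by apply: lt_trans hd; move: ti; rewrite -natr1; lra.
  rewrite [ltRHS]splitr; apply: le_lt_trans (ltrD gt (qP _ iN)).
  exact: ler_distD.
exists (n, q, k); split => // f fc t tT.
have := gc t tT; have := fc t tT => /=.
set z := ratr _ => h1 h2.
rewrite (_ : g t - f t = (g t - z) - (f t - z)); last by lra.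
apply: le_lt_trans (ler_normB _ _) _.
by rewrite [e]splitr ltrD// (lt_trans _ ke).
Qed.

Lemma curve_open_tube (R : realType) (T : {posnum R}) (g : curve T)
    (U : set (curve T)) : open U -> U g ->
  exists c, step_tube c g /\ step_tube c `<=` U.
Proof.
move=> oU Ug.
have [B oB BU] : exists2 B : set {uniform` `[(0 : R), T%:num]%classic -> R},
    open B & set_val @^-1` B = U by exact: oU.
have : nbhs (set_val g : {uniform` `[(0 : R), T%:num]%classic -> R}) B.
  by apply: open_nbhs_nbhs; split => //; move: Ug; rewrite -BU.
move=> /uniform_nbhs[E [entE EB]].
have [e /= e0 eE] : exists2 e : R, 0 < e & forall x y, `|x - y| < e -> E (x, y).
  move: entE; rewrite -entourage_ballE => -[e /= e0 eE].
  by exists e => // x y xy; apply: eE; rewrite /= -ball_normE.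
have [c [gc cg]] := step_tube_approx g e0.
exists c; split => // f fc; rewrite -BU; apply: EB => y yT; apply: eE.
by apply: cg => //; move: yT; rewrite /= in_itv.
Qed.

(** A measure charges only its topological support. A curve outside the support
has an open null neighbourhood, and that neighbourhood contains a tube around
the curve; there are countably many tubes, so countably many null sets cover
the complement of the support. *)
Lemma negligible_compl_support (R : realType) (T : {posnum R})
    (mu : {measure set (borel_curve T) -> \bar R}) :
  mu.-negligible (~` topological_support (mu : set (curve T) -> \bar R)).
Proof.
pose null c (U : set (curve T)) := [/\ open U, mu U = 0 & step_tube c `<=` U].
have Wex c : exists V,
    mu.-negligible V /\ forall U, null c U -> step_tube c `<=` V.
  have [[U [oU U0 cU]]|nU] := pselect (exists U, null c U).
    exists U; split => //; exists U; split => //; exact: sub_sigma_algebra.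
  exists set0; split; first exact: negligible_set0.
  by move=> U nullU; exfalso; apply: nU; exists U.
pose W c := sval (cid (Wex c)).
have WP c : mu.-negligible (W c) /\ forall U, null c U -> step_tube c `<=` W c.
  exact: svalP (cid (Wex c)).
pose V n : set (borel_curve T) := if unpickle n is Some c then W c else set0.
have nV : mu.-negligible (\bigcup_n V n).
  apply: negligible_bigcup => n; rewrite /V; case: unpickle => [c|].
    by have [] := WP c.
  exact: negligible_set0.
apply: negligibleS nV => /=.
move=> g /existsNP[U /not_implyP[oU /not_implyP[Ug /negP U0]]].
have [c [gc cU]] := curve_open_tube oU Ug.
exists (pickle c) => //; rewrite /V pickleK.
have [_ /(_ U)] := WP c; apply => //; split => //.
by apply/eqP; rewrite eq_le measure_ge0 andbT leNgt.
Qed.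

(** * Condition (sigma) and the Lasry-Lions condition *)

Lemma bounded_measurable_integrable (R : realType) (m : probability R R)
    (phi : R -> R) :
  measurable_fun setT phi -> (exists M : R, forall x, `|phi x| <= M) ->
  m.-integrable setT (EFin \o phi).
Proof.
move=> mphi [M phiM]; apply: measurable_bounded_integrable => //.
- by rewrite /= probability_setT ltry.
- exists M; split; first exact: num_real.
  by move=> K MK x _; apply: le_trans (phiM x) _; exact: ltW.
Qed.

Lemma measurable_sublevel (R : realType) (phi : R -> R) (c : R) :
  measurable_fun setT phi -> measurable [set y | phi y < c].
Proof.
move=> mphi; rewrite (_ : [set _ | _] = setT `&` phi @^-1` `]-oo, c[%classic).
  by apply: mphi => //; exact: measurable_itv.
by apply/seteqP; split => y /=; rewrite in_itv/=; [split|case].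
Qed.

Lemma sigma_T_ge (R : realType) (m : probability R R) (phi : R -> R) (c : R) :
  measurable_fun setT phi -> (exists M : R, forall x, `|phi x| <= M) ->
  m [set y | phi y < c] = 0%E -> c <= sigma_T phi m.
Proof.
(* almost surely equal to phi, and bounded below by c everywhere *)
move=> mphi bphi m0; pose psi y := Num.max c (phi y).
have mpsi : measurable_fun setT psi.
  by apply: (@measurable_maxr _ _ _ _ (cst c)) => //; exact: measurable_cst.
have -> : sigma_T phi m = \int[m]_x psi x.
  rewrite /sigma_T /Rintegral; congr fine; apply: ae_eq_integral => //.
  - exact/measurable_EFinP.
  - exact/measurable_EFinP.
  - exists [set y | phi y < c]; split => //.
      exact: measurable_sublevel.
    move=> x /= H; rewrite ltNge; apply/negP => cx; apply: H => _.
    by rewrite /psi max_r.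
have -> : c = \int[m]_x (cst c x).
  by rewrite Rintegral_cst//= [X in fine X](@probability_setT _ _ _ m) mulr1.
apply: le_Rintegral => //.
- exact: finite_measure_integrable_cst.
- apply: bounded_measurable_integrable => //.
  have [M phiM] := bphi; exists (`|c| + M) => x; rewrite /psi.
  have := phiM x; have := normr_ge0 c; have := normr_ge0 (phi x).
  by case: (leP c (phi x)); lra.
- by move=> x _; rewrite /psi le_max lexx.
Qed.

Lemma sigma_TN (R : realType) (m : probability R R) (phi : R -> R) :
  measurable_fun setT phi -> (exists M : R, forall x, `|phi x| <= M) ->
  sigma_T (\- phi) m = - sigma_T phi m.
Proof.
move=> mphi bphi; rewrite /sigma_T -[RHS]mulN1r -RintegralZl//; last first.
  exact: bounded_measurable_integrable.
by apply: eq_Rintegral => x _; rewrite mulN1r.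
Qed.

Lemma sigma_T_le (R : realType) (m : probability R R) (phi : R -> R) (c : R) :
  measurable_fun setT phi -> (exists M : R, forall x, `|phi x| <= M) ->
  m [set y | c < phi y] = 0%E -> sigma_T phi m <= c.
Proof.
move=> mphi bphi m0; rewrite -lerN2 -sigma_TN//; apply: sigma_T_ge.
- exact: measurableT_comp.
- by have [M phiM] := bphi; exists M => x; rewrite normrN.
- rewrite -m0; congr (m _); apply/seteqP.
  by split => y /=; rewrite ltrN2.
Qed.

(** For an initial Dirac mass the disintegration reduces to its fibre over x0:
eta is the conditional measure at x0, whose support lies in M x0. *)
Lemma disintegrates_in_dirac_null (R : realType) (T : {posnum R}) (x0 : R)
    (M : R -> set (curve T)) (eta : probability (borel_curve T) R)
    (A : set (borel_curve T)) :
  disintegrates_in (\d_x0 : probability R R) M eta -> measurable A ->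
  (forall g, M x0 g -> ~ A g) -> eta A = 0%E.
Proof.
move=> [kappa [etaE _] [N [mN N0 MN]]] mA MA.
rewrite etaE// integral_dirac//; last exact: measurable_kernel.
rewrite diracT mul1e.
have supM : topological_support (kappa x0 : set (curve T) -> \bar R) `<=` M x0.
  apply: contrapT => H; have : N x0 by exact: MN.
  move=> Nx0; move: N0; rewrite /= diracE mem_set// => /eqP.
  by rewrite gt_eqF.
have [B [mB B0 AB]] : (kappa x0).-negligible A.
  apply: negligibleS (negligible_compl_support (kappa x0)).
  by move=> g Ag /supM /MA; apply.
by apply: (subset_measure0 mA mB AB).
Qed.

Lemma sigma_T_endpoint_ge (R : realType) (T : {posnum R}) (x0 : R)
    (M : R -> set (curve T)) (eta : probability (borel_curve T) R)
    (phi : R -> R) (c : R) :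
  measurable_fun setT phi -> (exists M : R, forall x, `|phi x| <= M) ->
  disintegrates_in (\d_x0 : probability R R) M eta ->
  (forall g, M x0 g -> c <= phi (g T%:num)) ->
  c <= sigma_T phi (distribution eta (@ev R T T%:num)).
Proof.
move=> mphi bphi Meta Mc; apply: sigma_T_ge => //=.
apply: (disintegrates_in_dirac_null Meta).
  rewrite -[X in measurable X]setTI; apply: measurable_ev => //.
  exact: measurable_sublevel.
by move=> g /Mc; rewrite /= leNgt => /negP.
Qed.

Lemma sigma_T_endpoint_le (R : realType) (T : {posnum R}) (x0 : R)
    (M : R -> set (curve T)) (eta : probability (borel_curve T) R)
    (phi : R -> R) (c : R) :
  measurable_fun setT phi -> (exists M : R, forall x, `|phi x| <= M) ->
  disintegrates_in (\d_x0 : probability R R) M eta ->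
  (forall g, M x0 g -> phi (g T%:num) <= c) ->
  sigma_T phi (distribution eta (@ev R T T%:num)) <= c.
Proof.
move=> mphi bphi Meta Mc; rewrite -lerN2 -sigma_TN//.
apply: (sigma_T_endpoint_ge _ _ Meta).
- exact: measurableT_comp.
- by have [K phiK] := bphi; exists K => x; rewrite normrN.
- by move=> g /Mc; rewrite /= lerN2.
Qed.

(** Comparison with the constant curve, whose action vanishes. *)
Lemma minimizer_energy_fin (R : realType) (T : {posnum R}) (h : R -> R) (x : R)
    (g : curve T) :
  minimizers (kinetic R) h x g ->
  (\int[lebesgue_measure]_(s in `[0%R, T%:num])
     (2^-1 * `|derive1 (g : R -> R) s| ^+ 2)%:E)%E \is a fin_num.
Proof.
move=> [_ /(_ (cst_curve T x))]; rewrite /J.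
have -> : (\int[lebesgue_measure]_(s in `[0%R, T%:num])
   (2^-1 * `|derive1 (cst_curve T x : R -> R) s| ^+ 2)%:E = 0)%E.
  apply: integral0_eq => s _.
  have -> : (cst_curve T x : R -> R) = cst x.
    by apply/funext => t; rewrite /curve_fun set_valE.
  by rewrite derive1_cst normr0 expr0n mulr0.
rewrite add0e => H.
rewrite ge0_fin_numE; last first.
  by apply: integral_ge0 => s _; rewrite lee_fin mulr_ge0// exprn_ge0.
have {}H := H erefl.
rewrite ltey; apply/eqP => E; move: H; rewrite E addye//.
Qed.

(** Exchange argument: adding the two inequalities which express that g1 and g2
are optimal for s1 and s2 cancels the (finite) actions and leaves
(s2 - s1) (phi (g2 T) - phi (g1 T)) <= 0. *)
Lemma minimizers_antitone (R : realType) (T : {posnum R}) (phi : R -> R)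
    (x s1 s2 : R) (g1 g2 : curve T) :
  s1 < s2 ->
  minimizers (kinetic R) (fun y => phi y * s1) x g1 ->
  minimizers (kinetic R) (fun y => phi y * s2) x g2 ->
  phi (g2 T%:num) <= phi (g1 T%:num).
Proof.
move=> s12 m1 m2.
have exchange (a b : \bar R) (p q : R) : a \is a fin_num -> b \is a fin_num ->
    (a + (p * s1)%:E <= b + (q * s1)%:E)%E ->
    (b + (q * s2)%:E <= a + (p * s2)%:E)%E -> q <= p.
  case: a => [a| |]// ; case: b => [b| |]// _ _.
  rewrite -!EFinD !lee_fin => h1 h2.
  rewrite -subr_ge0 -(@pmulr_rge0 _ (s2 - s1)) ?subr_gt0//; lra.
have f1 := minimizer_energy_fin m1; have f2 := minimizer_energy_fin m2.
case: m1 => x1 /(_ g2); case: m2 => x2 /(_ g1) => h2 h1.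
exact: exchange f1 f2 (h1 x2) (h2 x1).
Qed.

(** The best response map sigma |-> E_T sigma is nonincreasing, by the exchange
argument integrated against two optimal plans. Hence
(t1 - t2) (s1 - s2) <= 0, which is below (s1 - s2) ^ 2 as soon as s1 and s2
differ. *)
Lemma kinetic_condition_sigma_strict (R : realType) (phi : R -> R) (x0 : R) :
  measurable_fun setT phi -> (exists M : R, forall x, `|phi x| <= M) ->
  condition_sigma_strict (kinetic R) phi (\d_x0 : probability R R).
Proof.
move=> mphi bphi.
have antitone (T : {posnum R}) s1 s2 t1 t2 : s1 < s2 ->
    E_T T (kinetic R) phi (\d_x0 : probability R R) s1 t1 ->
    E_T T (kinetic R) phi (\d_x0 : probability R R) s2 t2 ->
    t2 <= t1.
  move=> s12 [eta1 [_ eta1P] <-] [eta2 [_ eta2P] <-].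
  apply: (sigma_T_endpoint_le mphi bphi eta2P) => g2 g2P.
  apply: (sigma_T_endpoint_ge mphi bphi eta1P) => g1 g1P.
  exact: minimizers_antitone s12 g1P g2P.
have strict (T : {posnum R}) s1 s2 t1 t2 : s1 != s2 ->
    E_T T (kinetic R) phi (\d_x0 : probability R R) s1 t1 ->
    E_T T (kinetic R) phi (\d_x0 : probability R R) s2 t2 ->
    (t1 - t2) * (s1 - s2) < `|s1 - s2| ^+ 2.
  move=> s12 h1 h2; apply: (@le_lt_trans _ _ 0); last first.
    by rewrite exprn_gt0// normr_gt0 subr_eq0.
  move: s12; rewrite neq_lt => /orP[s12|s12].
    by rewrite mulr_ge0_le0 ?subr_ge0 ?subr_le0 ?(ltW s12)// (antitone T s1 s2).
  by rewrite mulr_le0_ge0 ?subr_ge0 ?subr_le0 ?(ltW s12)// (antitone T s2 s1).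
split => T s1 s2 t1 t2 _ _ h1 h2; last by move=> s12; exact: strict h1 h2.
have [<-|s12] := eqVneq s1 s2; first by rewrite subrr mulr0 normr0 expr0n.
exact/ltW/(strict _ _ _ _ _ s12 h1 h2).
Qed.

(** The Lasry-Lions integral of phi x * sigma_T m is the square of
sigma_T m1 - sigma_T m2, and G depends on m through sigma_T m only. *)
Lemma multiplicative_LL_strong (R : realType) (phi : R -> R) :
  measurable_fun setT phi -> (exists M : R, forall x, `|phi x| <= M) ->
  LL_strong (separable_cost phi).
Proof.
move=> mphi bphi.
have E m1 m2 : LL_integral (separable_cost phi) m1 m2 =
    (sigma_T phi m1 - sigma_T phi m2) ^+ 2.
  rewrite /LL_integral.
  have key (m : probability R R) :
      \int[m]_x (phi x * sigma_T phi m1 - phi x * sigma_T phi m2) =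
      (sigma_T phi m1 - sigma_T phi m2) * sigma_T phi m.
    rewrite -RintegralZl//; last exact: bounded_measurable_integrable.
    by apply: eq_Rintegral => x _; ring.
  by rewrite !key; ring.
split => [m1 m2 _ _|m1 m2 _ _]; first by rewrite E sqr_ge0.
by rewrite E => /eqP; rewrite sqrf_eq0 subr_eq0 => /eqP -> x.
Qed.

(** * Equilibria carried by a straight line *)

Lemma line_curve_subproof (R : realType) (T : {posnum R}) (x v : R) :
  ((fun t => x + v * clip 0 T%:num t)
     : {uniform` `[(0 : R), T%:num]%classic -> R}) \in @curve_set R T.
Proof.
rewrite inE; split.
- move=> e e0; exists (e / (`|v| + 1)); first by rewrite divr_gt0// ltr_wpDl.
  move=> n l r lr _; rewrite ltr_pdivlMr ?ltr_wpDl// => lre.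
  have S0 : 0 <= \sum_(i < n) (r i - l i).
    by apply: sumr_ge0 => i _; have [_ /ltW] := lr i; rewrite subr_ge0.
  apply: le_lt_trans lre; rewrite mulrDr mulr1 mulr_suml.
  apply: (@le_trans _ _ (\sum_(i < n) (r i - l i) * `|v|)).
    apply: ler_sum => i _; have [l0 lri rT] := lr i.
    have r0 : 0 <= r i by exact: le_trans (ltW lri).
    have lT : l i <= T%:num by exact: le_trans (ltW lri) _.
    rewrite !clip_id// (_ : _ - _ = (r i - l i) * v); last by ring.
    by rewrite normrM ger0_norm// subr_ge0 ltW.
  by rewrite lerDl.
- move=> t t0; congr (_ + v * _); rewrite [RHS]clip_id//.
  by rewrite /clip max_l// ge_min t0 orbT.
- move=> t tT; congr (_ + v * _).
  by rewrite /clip min_l// min_l.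
Qed.

Definition line_curve (R : realType) (T : {posnum R}) (x v : R) : curve T :=
  SigSub (line_curve_subproof T x v).

Lemma line_curveE (R : realType) (T : {posnum R}) (x v t : R) :
  0 <= t <= T%:num -> line_curve T x v t = x + v * t.
Proof. by move=> /andP[t0 tT]; rewrite /curve_fun set_valE /= clip_id. Qed.

Lemma line_curve_energy (R : realType) (T : {posnum R}) (x v : R) :
  (\int[lebesgue_measure]_(s in `[0%R, T%:num])
      (2^-1 * `|derive1 (line_curve T x v : R -> R) s| ^+ 2)%:E)%E =
  (2^-1 * v ^+ 2 * T%:num)%:E.
Proof.
have dv s : s \in `]0, T%:num[%classic ->
    (2^-1 * `|derive1 (line_curve T x v : R -> R) s| ^+ 2)%:E =
    (2^-1 * v ^+ 2)%:E.
  rewrite inE /= in_itv/= => /andP[s0 sT].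
  suff -> : derive1 (line_curve T x v : R -> R) s = v.
    by rewrite real_normK ?num_real.
  rewrite derive1E (@near_eq_derive _ _ _ _ (fun t => x + v * t)).
    rewrite deriveD// derive_cst add0r deriveM// derive_cst derive_id.
    rewrite scaler0 addr0.
    by rewrite /GRing.scale /= mulr1.
  near=> t; rewrite line_curveE//.
  by apply/andP; split; apply/ltW; near: t; [exact: lt_nbhsr|exact: lt_nbhsl].
rewrite integral_itv_bndoo; last first.
  apply/(eq_measurable_fun (cst (2^-1 * v ^+ 2)%:E)) => [s sT|].
    by rewrite dv.
  exact: measurable_cst.
rewrite (eq_integral (cst (2^-1 * v ^+ 2)%:E)); last by move=> s /dv.
rewrite integral_cst//= lebesgue_measure_itv/= lte_fin.
by rewrite gt0// -EFinB -EFinM subr0.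
Unshelve. all: by end_near. Qed.

(** By the bound on the action, the cost of a curve ending at w is at least the
right-hand side of the hypothesis, so the problem over curves reduces to a
minimization over endpoints. *)
Lemma line_curve_minimizer (R : realType) (T : {posnum R}) (h : R -> R)
    (x v : R) :
  (forall w, 2^-1 * v ^+ 2 * T%:num + h (x + v * T%:num) <=
     (w - x) ^+ 2 / (2 * T%:num) + h w) ->
  minimizers (kinetic R) h x (line_curve T x v).
Proof.
move=> hmin; split.
  by rewrite /curves_from /= line_curveE ?lexx//= mulr0 addr0.
move=> g gx; rewrite /J line_curve_energy line_curveE ?lexx ?andbT//.
have [acg _ _] : @curve_set R T (set_val g) by apply: set_valP.
have Eg := energy_ge (gt0 T) acg; rewrite subr0 -/(curve_fun g) in Eg.
apply: (@le_trans _ _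
  (((g T%:num - g 0) ^+ 2 / (2 * T%:num))%:E + (h (g T%:num))%:E)%E).
  by rewrite -!EFinD lee_fin gx.
apply: (@leeD _ _ _ _ _ _ (lexx _)).
exact: Eg.
Qed.

Lemma sigma_T_dirac (R : realType) (T : {posnum R}) (phi : R -> R)
    (g : borel_curve T) :
  measurable_fun setT phi -> (exists M : R, forall x, `|phi x| <= M) ->
  sigma_T phi
    (distribution (\d_g : probability (borel_curve T) R) (@ev R T T%:num)) =
  phi (ev T%:num g).
Proof.
move=> mphi bphi; apply/eqP; rewrite eq_le sigma_T_le ?sigma_T_ge//=;
  by rewrite /distribution /pushforward diracE memNset//= ltxx.
Qed.

Lemma ae_dirac (R : realType) (x0 : R) (P : R -> Prop) :
  P x0 -> {ae (\d_x0 : probability R R), forall x, P x}.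
Proof.
move=> Px0; exists (~` [set x0]); split.
- by apply: measurableC; exact: measurable_set1.
- by rewrite /= diracE memNset// => /(_ erefl).
- by move=> x; apply: contra_not => ->.
Qed.

(** The support of a Dirac mass is its base point because evaluations are
continuous and separate curves; the constant kernel disintegrates it. *)
Lemma dirac_equilibrium (R : realType) (T : {posnum R}) (L : R -> R -> R)
    (G : R -> probability R R -> R) (x0 : R) (g : curve T) :
  let eta : probability (borel_curve T) R := \d_(g : borel_curve T) in
  minimizers L (fun x => G x (distribution eta (@ev R T T%:num))) x0 g ->
  equilibrium L G (\d_x0 : probability R R) eta.
Proof.
move=> eta; set M := minimizers _ _ _ => Mg; have [gx0 _] := Mg.
have supp : topological_support
    (\d_(g : borel_curve T) : set (curve T) -> \bar R) `<=` [set g].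
  move=> f fsupp; apply: val_inj; apply/funext => t; apply/eqP/negPn/negP => fg.
  pose U : set (curve T) :=
    (fun f : curve T => curve_fun f t) @^-1` [set y | y != g t].
  have oU : open U.
    apply: open_comp; first by move=> ? _; exact: continuous_ev.
    exact: open_neq.
  have : (0 < (\d_(g : borel_curve T) (U : set (borel_curve T)) : \bar R))%E.
    exact: fsupp U oU fg.
  by rewrite diracE memNset ?ltxx// /U /= eqxx.
split.
  move=> A mA; rewrite /distribution /pushforward /= !diracE -gx0.
  suff -> : (g \in ev 0 @^-1` A) = (g 0 \in A) by [].
  by apply/idP/idP; rewrite !inE.
have mg : measurable_fun [set: R] (cst (g : borel_curve T)).
  exact: measurable_cst.
exists (kdirac mg : R.-pker R ~> borel_curve T).
  split.
    move=> A mA; rewrite integral_dirac//; last exact: measurable_kernel.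
    by rewrite diracT mul1e.
  by apply: ae_dirac => f /supp ->.
by apply: ae_dirac => f /supp ->.
Qed.

(** The function is continuous, and where (w - x0) ^ 2 >= 2 lam phi(x0) it
exceeds its value at x0, so the minimum over a compact interval is global. *)
Lemma penalized_minimizer (R : realType) (phi : R -> R) (x0 lam : R) :
  continuous phi -> (forall x, 0 < phi x) -> 0 < lam ->
  exists y, forall w,
    (y - x0) ^+ 2 / (2 * lam) + phi y <= (w - x0) ^+ 2 / (2 * lam) + phi w.
Proof.
move=> cphi phi0 lam0.
pose F w := (w - x0) ^+ 2 / (2 * lam) + phi w.
have lam20 : 0 < 2 * lam by rewrite mulr_gt0.
have cF : continuous F.
  move=> w; apply: cvgD; last exact: cphi.
  apply: cvgM; last exact: cvg_cst.
  rewrite /=; under eq_fun do rewrite expr2.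
  by rewrite expr2; apply: cvgM; apply: cvgB; (exact: cvg_id || exact: cvg_cst).
(* the 1 ensures r <= r ^ 2 *)
pose r := 1 + 2 * lam * phi x0.
have P0 : 0 < 2 * lam * phi x0 by rewrite mulr_gt0.
have r0 : 0 < r by rewrite /r; lra.
have [||y yr yF] := @EVT_min R F (x0 - r) (x0 + r).
- by lra.
- exact: continuous_subspaceT.
exists y => w; rewrite -/(F y) -/(F w).
have [wr|wr] := boolP (w \in `[x0 - r, x0 + r]); first exact: yF.
have : F y <= F x0 by apply: yF; rewrite in_itv/=; apply/andP; split; lra.
move=> /le_trans; apply.
rewrite /F subrr expr0n mul0r add0r.
suff : phi x0 <= (w - x0) ^+ 2 / (2 * lam) by have := phi0 w; lra.
rewrite ler_pdivlMr// mulrC.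
have rr : r <= r ^+ 2 by rewrite expr2 ler_peMl ?(ltW r0)// /r; lra.
apply: (@le_trans _ _ (r ^+ 2)); first by move: rr; rewrite /r; lra.
rewrite -[leRHS]real_normK ?num_real// ler_sqr ?nnegrE ?(ltW r0)//.
move: wr; rewrite in_itv/= negb_and -!ltNge => /orP[h|h].
  by rewrite ltr0_norm; lra.
by rewrite gtr0_norm; lra.
Qed.

(** The fixed point condition sigma = phi y is solved by choosing the horizon.
With T = lam / phi y the cost (w - x0) ^ 2 / (2 T) + phi w * phi y of ending at
w is phi y times the function minimized by y, whatever the value of phi y. *)
Lemma straight_line_equilibrium (R : realType) (phi : R -> R) (x0 lam y : R)
    (T : {posnum R}) :
  measurable_fun setT phi -> (exists M : R, forall x, `|phi x| <= M) ->
  (forall x, 0 < phi x) -> 0 < lam -> T%:num = lam / phi y ->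
  (forall w, (y - x0) ^+ 2 / (2 * lam) + phi y <=
             (w - x0) ^+ 2 / (2 * lam) + phi w) ->
  equilibrium (kinetic R)
    (separable_cost phi)
    (\d_x0 : probability R R)
    (\d_(line_curve T x0 ((y - x0) / T%:num) : borel_curve T)
       : probability (borel_curve T) R).
Proof.
move=> mphi bphi phi0 lam0 TE ymin.
have T0 : T%:num != 0 by rewrite gt_eqF.
have phiy : phi y != 0 by rewrite gt_eqF.
have lam1 : lam != 0 by rewrite gt_eqF.
have yE : x0 + (y - x0) / T%:num * T%:num = y by rewrite divfK// addrC subrK.
apply: dirac_equilibrium; rewrite sigma_T_dirac//.
have -> : ev T%:num (line_curve T x0 ((y - x0) / T%:num) : borel_curve T) = y.
  by rewrite /ev line_curveE ?lexx ?andbT.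
apply: line_curve_minimizer => w; rewrite yE.
rewrite TE.
have -> : 2^-1 * ((y - x0) / (lam / phi y)) ^+ 2 * (lam / phi y) +
      phi y * phi y = ((y - x0) ^+ 2 / (2 * lam) + phi y) * phi y.
  by field; rewrite phiy lam1.
have -> : (w - x0) ^+ 2 / (2 * (lam / phi y)) + phi w * phi y =
    ((w - x0) ^+ 2 / (2 * lam) + phi w) * phi y by field; rewrite phiy lam1.
by rewrite ler_pM2r.
Qed.

(** * Strict condition (sigma) and (LL) without uniqueness *)

Theorem proposition3p7 (R : realType) (phi : R -> R) (x0 z : R)
  (phi_gt0 : forall x, 0 < phi x)
  (phi_bounded : exists M : R, forall x, `|phi x| <= M)
  (phi_continuous : continuous phi)
  (z_gt0 : 0 < z)
  (phi_sym : forall y, phi (x0 + y) = phi (x0 - y))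
  (phi_lt : phi (x0 + z) < phi x0)
  (phi_decreasing : forall x y, x0 < x -> x <= y -> y < x0 + z ->
     phi y <= phi x)
  (phi_increasing : forall x y, x0 + z < x -> x <= y -> phi x <= phi y) :
  let L := fun _ v : R => 2^-1 * `|v| ^+ 2 in
  let G := fun (x : R) (m : probability R R) => phi x * sigma_T phi m in
  let m0 : probability R R := \d_x0 in
  [/\ condition_sigma_strict L phi m0,
      LL_strong G &
      exists (T : {posnum R}) (eta1 eta2 : probability (borel_curve T) R),
        [/\ equilibrium L G m0 eta1, equilibrium L G m0 eta2 &
            distinct_measures eta1 eta2]].
Proof.
have mphi : measurable_fun setT phi by exact: continuous_measurable_fun.
move=> L G m0; split.
- exact: kinetic_condition_sigma_strict.
- exact: multiplicative_LL_strong.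
pose delta := phi x0 - phi (x0 + z).
have delta0 : 0 < delta by rewrite subr_gt0.
pose lam := z ^+ 2 / delta.
have lam0 : 0 < lam by rewrite divr_gt0// exprn_gt0.
have [y ymin] := penalized_minimizer x0 phi_continuous phi_gt0 lam0.
have y_neq : y != x0.
  apply/eqP => yx0; have := ymin (x0 + z).
  rewrite yx0 subrr expr0n mul0r add0r addrAC subrr add0r.
  have -> : z ^+ 2 / (2 * lam) = delta / 2.
    by rewrite /lam; field; rewrite !gt_eqF.
  by move: delta0; rewrite /delta; lra.
pose y' := 2 * x0 - y.
have phiy' : phi y' = phi y.
  have -> : y' = x0 - (y - x0) by rewrite /y'; ring.
  by rewrite -phi_sym addrC subrK.
have y'min w : (y' - x0) ^+ 2 / (2 * lam) + phi y' <=
    (w - x0) ^+ 2 / (2 * lam) + phi w.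
  have -> : (y' - x0) ^+ 2 = (y - x0) ^+ 2 by rewrite /y'; ring.
  by rewrite phiy'.
have T_gt0 : 0 < lam / phi y by rewrite divr_gt0.
pose T : {posnum R} := PosNum T_gt0.
have TE : T%:num = lam / phi y by [].
have T'E : T%:num = lam / phi y' by rewrite phiy'.
pose g := line_curve T x0 ((y - x0) / T%:num).
pose g' := line_curve T x0 ((y' - x0) / T%:num).
exists T, (\d_(g : borel_curve T)), (\d_(g' : borel_curve T)); split.
- exact: straight_line_equilibrium mphi phi_bounded phi_gt0 lam0 TE ymin.
- exact: straight_line_equilibrium mphi phi_bounded phi_gt0 lam0 T'E y'min.
have gT : g T%:num = y.
  by rewrite line_curveE ?lexx ?andbT// divfK ?gt_eqF// addrC subrK.
have g'T : g' T%:num = y'.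
  by rewrite line_curveE ?lexx ?andbT// divfK ?gt_eqF// addrC subrK.
exists (setT `&` @ev R T T%:num @^-1` [set y]).
  by apply: measurable_ev => //; exact: measurable_set1.
rewrite /= !diracE mem_set; last by split.
rewrite memNset; first by move=> [] /eqP; rewrite oner_eq0.
rewrite /= /ev g'T => -[_ yy].
by move/eqP : y_neq; apply; move: yy; rewrite /y'; lra.
Qed.
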